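(* For every positive integer $k$, every $k$-tree is odd $\left(k+2\left\lfloor\log_2 k\right\rfloor+3\right)$-colorable.
   Context: All graphs are simple, finite and undirected. For a positive integer $m$, $[m]=\{1,\dots,m\}$. A $m$-coloring of a graph $G$ is a map $\varphi:V(G)\to[m]$ with $\varphi(u)\neq\varphi(v)$ for every edge $uv$ (a proper coloring). A vertex $v$ satisfies the odd condition with respect to $\varphi$ if $|\varphi^{-1}(i)\cap N_G(v)|$ is odd for some color $i$. An odd $m$-coloring of $G$ is an $m$-coloring such that every non-isolated vertex satisfies the odd condition; $G$ is odd $m$-colorable if it has one. For a positive integer $k$, a graph $G$ is a $k$-tree if there is a sequence $G_0,G_1,\dots,G_s$ of induced subgraphs of $G$ with $G_0\cong K_{k+1}$, $G_s=G$, and for each $i\in[s]$, $V(G_i)=V(G_{i-1})\cup\{x_i\}$ for a new vertex $x_i$ whose set of neighbors in $V(G_{i-1})$ is a clique of order $k$ in $G$. *)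

(* Defs.v *)
From mathcomp Require Import all_boot.
Set Implicit Arguments. Unset Strict Implicit. Unset Printing Implicit Defensive.

Record sgraph := SGraph {
  vertex :> finType;
  adj : rel vertex;
  adj_sym : symmetric adj;
  adj_irr : irreflexive adj }.

Definition neighbors (G : sgraph) (v : G) : {set G} := [set u | adj v u].

Definition is_clique (G : sgraph) (K : {set G}) : Prop :=
  forall u v : G, u \in K -> v \in K -> u != v -> adj u v.

Definition proper_coloring (m : nat) (G : sgraph) (phi : G -> 'I_m) : Prop :=
  forall u v : G, adj u v -> phi u != phi v.

Definition odd_condition (m : nat) (G : sgraph) (phi : G -> 'I_m) (v : G) : Prop :=
  exists i : 'I_m, odd #|[set u | phi u == i] :&: neighbors v|.

Definition isolated (G : sgraph) (v : G) : Prop := neighbors v = set0.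

Definition odd_coloring (m : nat) (G : sgraph) (phi : G -> 'I_m) : Prop :=
  proper_coloring phi /\ forall v : G, ~ isolated v -> odd_condition phi v.

Definition odd_colorable (m : nat) (G : sgraph) : Prop :=
  exists phi : G -> 'I_m, odd_coloring phi.

(* An induced subgraph is given by its vertex set: [V i] is the vertex set of
   the i-th graph of the construction sequence, and only the values
   [V 0, ..., V s] matter. *)
Definition ktree (k : nat) (G : sgraph) : Prop :=
  exists (s : nat) (V : nat -> {set G}),
    [/\ is_clique (V 0) /\ #|V 0| = k.+1,
        V s = [set: G] &
        forall i : nat, i < s ->
          exists x : G,
            [/\ x \notin V i,
                V i.+1 = x |: V i,
                is_clique (neighbors x :&: V i) &
                #|neighbors x :&: V i| = k]].

(* Main.v *)
(** Put [L = trunc_log 2 k + 1], so that [k < 2 ^ L] and there are [k + 2L + 1]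
    colours.  Order the vertices by insertion time; the earlier neighbours of an
    inserted vertex form a [k]-clique, and its parent is the last inserted of
    them, which turns the [k]-tree into a rooted tree of bags.  Induct on the
    number of vertices, deleting some at the end of the tree and recolouring them.

    Below the youngest vertex with two children, all branches are paths.
    - If one of them has at least [t = L/2 + 1] vertices, delete its last [t]
      vertices and reinsert them with pairwise distinct colours.  A vertex met by
      all of them fails only if its set of odd colours is exactly the set of
      the [t] new colours.  Picking each colour by averaging, at most [k] sets of
      odd colours can be avoided because [k < 2 ^ L <= 'C(2L, t)].
    - If two of them have at most [L/2] vertices, delete both end leaves and
      reinsert them with a common colour.  Only the few vertices adjacent to
      exactly one of the leaves change parity, so the colour can be chosen
      to keep them satisfied.
    - If nothing branches, either the whole tree is a path with [t] or more
      vertices below the root, or there are enough colours to use each one once. *)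

Require Import Defs.
From mathcomp Require Import all_boot.
From mathcomp Require Import zify.
Set Implicit Arguments. Unset Strict Implicit. Unset Printing Implicit Defensive.

(** * Counting bounds *)

(** Raising [L] by 2 multiplies the left side by 4, and Pascal's rule splits ['C(n + 4, t + 1)] into
    four terms that are each at least ['C(n, t)], plus one more. *)
Lemma expn2_le_bin_half L : 0 < L -> 2 ^ L <= 'C(2 * L, L./2.+1).
Proof.
case: L => // L _; elim/ltn_ind: L => -[|[|L]] IH //.
have {IH} := IH L (ltnW (ltnSn _)).
have -> : L.+3./2.+1 = L.+1./2.+2 by [].
move: L.+1./2.+1 => t IH.
have -> : 2 * L.+3 = (2 * L.+1).+4 by lia.
have -> : 2 ^ L.+3 = 4 * 2 ^ L.+1 by rewrite !expnS; lia.
move: (2 * L.+1) IH => n IH; rewrite 4!binS.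
by have := leq_bin2l t (leqnSn n); have := leq_bin2l t (leqnSn n.+1);
   have := leq_bin2l t (leqnSn n.+2); lia.
Qed.

Lemma leq_card_setU_trans (T : finType) (A B : {set T}) a b :
  #|A| <= a -> #|B| <= b -> #|A :|: B| <= a + b.
Proof. by move=> Aa Bb; apply: leq_trans (leq_card_setU _ _).1 (leq_add Aa Bb). Qed.

(** * Insertion ranks, closed sets and the tree of bags *)

Section Elimination.

Variables (G : sgraph) (k : nat) (rk : G -> nat).

Definition earlier v : {set G} := [set u | adj v u & rk u < rk v].
(** The vertices of the starting clique all share rank 0; only positive ranks are distinct. *)
Definition base : {set G} := [set v | rk v == 0].

Hypothesis k_gt0 : 0 < k.
Hypothesis base_clique : is_clique base.
Hypothesis card_base : #|base| = k.+1.
Hypothesis rk_inj : forall u v, 0 < rk u -> rk u = rk v -> u = v.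
Hypothesis earlier_clique : forall v, 0 < rk v -> is_clique (earlier v).
Hypothesis card_earlier : forall v, 0 < rk v -> #|earlier v| = k.

(** Such a set induces a smaller [k]-tree built in the same order; the induction runs over these
    sets. *)
Definition closed (W : {set G}) : Prop :=
  base \subset W /\ forall v, v \in W -> earlier v \subset W.

(* [None] stands for the root, whose bag is [base]. *)
Definition parent v : option G :=
  [pick p in earlier v | (0 < rk p) && [forall u in earlier v, rk u <= rk p]].

Definition bag (a : option G) : {set G} :=
  if a is Some p then p |: earlier p else base.

Lemma parent_earlier v p : parent v = Some p -> p \in earlier v /\ 0 < rk p.
Proof. by rewrite /parent; case: pickP => // q /and3P[? ? _] [<-]. Qed.

Lemma parent_lt v p : parent v = Some p -> rk p < rk v.
Proof. by move/parent_earlier => [+ _]; rewrite inE => /andP[]. Qed.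

Lemma parent_gt0 v p : parent v = Some p -> 0 < rk v.
Proof. by move/parent_lt; apply: leq_trans. Qed.

(** The earlier neighbours form a clique, so all but the youngest, [p], are earlier neighbours of
    [p]. If none has positive rank, they lie in [base]. *)
Lemma earlier_sub_bag v : 0 < rk v -> earlier v \subset bag (parent v).
Proof.
move=> v0; rewrite /parent; case: pickP => [p /and3P[pK p0 /forall_inP pmax] | np].
  apply/subsetP => u uK; rewrite /= !inE.
  have [//|up /=] := eqVneq u p.
  have le := pmax _ uK.
  rewrite (earlier_clique v0 pK uK) 1?eq_sym //= ltn_neqAle le andbT.
  by apply: contraNneq up => e; apply/eqP/esym/rk_inj.
apply/subsetP => u uK; rewrite /= inE; apply: contraT; rewrite -lt0n => u0.
case: (@arg_maxnP _ u (fun w => w \in earlier v) rk uK) => p pK pmax.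
have := np p; rewrite /= pK (leq_trans u0 (pmax _ uK)) /=.
by move/negP; case; apply/forall_inP.
Qed.

(** [0 < rk v] excludes the vertices of [base], whose parent is also [None]. *)
Definition children (W : {set G}) a := [set v in W | (0 < rk v) && (parent v == a)].

Definition child_closed (W D : {set G}) : Prop :=
  [/\ {in D, forall v, 0 < rk v}
    & forall v p, v \in W -> parent v = Some p -> p \in D -> v \in D].

(** Climb from [v] to its parent: [u] is the parent or one of its earlier neighbours, so closure
    under children yields closure under later neighbours. *)
Lemma later_in_child_closed W D u v : closed W -> child_closed W D ->
  v \in W -> u \in earlier v -> u \in D -> v \in D.
Proof.
move=> [_ clW] [D0 cD]; have [n] := ubnP (rk v); elim: n => // n IH in v *.
rewrite ltnS => vn vW uv uD; have u0 := D0 _ uD.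
have v0 : 0 < rk v by move: uv; rewrite inE => /andP[_]; apply: leq_trans.
have /subsetP/(_ u uv) := earlier_sub_bag v0.
case ep: (parent v) => [p|] /=; last by rewrite inE eqn0Ngt u0.
have [pv _] := parent_earlier ep.
have pW : p \in W := subsetP (clW _ vW) _ pv.
case/setU1P => [eup | up]; first by apply: (cD _ _ vW ep); rewrite -eup.
by apply: (cD _ _ vW ep); apply: IH => //; apply: leq_trans (parent_lt ep) vn.
Qed.

Lemma closed_setD W D : closed W -> child_closed W D -> closed (W :\: D).
Proof.
move=> clW cD; have [D0 _] := cD; split.
  apply/subsetP => v vb; rewrite inE (subsetP clW.1) // andbT.
  by apply/negP => /D0; move: vb; rewrite inE => /eqP ->.
move=> v /setDP[vW vD]; apply/subsetP => u uv.
rewrite inE (subsetP (clW.2 _ vW)) // andbT.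
by apply: contra vD; apply: (later_in_child_closed clW cD vW uv).
Qed.

Lemma neighbor_closed W x u : closed W -> x \notin W -> 0 < rk x ->
  u \in W -> adj x u -> u \in earlier x.
Proof.
move=> [_ clW] xW x0 uW xu; rewrite inE xu /= ltnNge; apply: contra xW.
rewrite leq_eqVlt => /predU1P[e | lt]; first by rewrite (rk_inj x0 e).
by apply: (subsetP (clW _ uW)); rewrite inE adj_sym xu.
Qed.

(** * Chains at the end of the tree *)

(** [x :: c] lists the whole subtree of [W] rooted at [x], a path whose last vertex is a leaf. *)
Fixpoint tail_chain (W : {set G}) x c : bool :=
  [&& x \in W, 0 < rk x &
    if c is y :: c' then (children W (Some x) == [set y]) && tail_chain W y c'
    else children W (Some x) == set0].

Lemma tail_chain_mem W x c : tail_chain W x c ->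
  forall y, y \in x :: c -> y \in W /\ 0 < rk y.
Proof.
elim: c x => [|z c IH] x /= /and3P[xW x0].
  by move=> _ y; rewrite inE => /eqP ->.
by move=> /andP[_ /IH h] y; rewrite inE => /predU1P[-> | /h].
Qed.

Lemma tail_chain_child_closed W x c :
  tail_chain W x c -> child_closed W [set y in x :: c].
Proof.
move=> tc; split=> [y | v p vW ep].
  by rewrite inE => /(tail_chain_mem tc)[].
have vc : v \in children W (Some p) by rewrite inE vW ep (parent_gt0 ep) eqxx.
rewrite !in_set; elim: c x tc => [|z c IH] x /= /and3P[xW x0].
  by move=> /eqP c0 /[!inE] /eqP e; move: vc; rewrite e c0 inE.
move=> /andP[/eqP ec tc]; rewrite inE => /predU1P[e|/(IH _ tc) h].
  by move: vc; rewrite e ec inE => /eqP ->; rewrite !inE eqxx orbT.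
by rewrite inE h orbT.
Qed.

Lemma tail_chain_parent W x y c : tail_chain W x (y :: c) -> parent y = Some x.
Proof.
move=> /= /and3P[_ _ /andP[/eqP ec _]].
have : y \in children W (Some x) by rewrite ec set11.
by rewrite inE => /and3P[_ _ /eqP].
Qed.

Lemma tail_chain_behead W x y c : tail_chain W x (y :: c) -> tail_chain W y c.
Proof. by case/and3P => _ _ /andP[]. Qed.

Lemma tail_chain_last W x c : tail_chain W x c -> tail_chain W (last x c) [::].
Proof. by elim: c x => // y c IH x /tail_chain_behead/IH. Qed.

Lemma tail_chain_drop W x c t : tail_chain W x c -> t <= size c ->
  exists y c', tail_chain W y c' /\ size c' = t.
Proof.
elim: c x => [|y c IH] x tc; first by rewrite leqn0 => /eqP ->; exists x, [::].
rewrite leq_eqVlt => /predU1P[-> | ]; first by exists x, (y :: c).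
by apply: IH (tail_chain_behead tc).
Qed.

Lemma tail_chain_uniq W x c : tail_chain W x c -> uniq (x :: c) /\
  {in c, forall y, rk x < rk y}.
Proof.
elim: c x => [//|y c IH] x tc.
have [un lt] := IH _ (tail_chain_behead tc).
have xy := parent_lt (tail_chain_parent tc).
have ltx : {in y :: c, forall z, rk x < rk z}.
  by move=> z; rewrite inE => /predU1P[-> // | /lt]; apply: ltn_trans.
split=> //; rewrite cons_uniq un andbT.
by apply/negP => /ltx; rewrite ltnn.
Qed.

Lemma tail_chain_exists (W : {set G}) x : x \in W -> 0 < rk x ->
  (forall y, y \in W -> rk x <= rk y -> #|children W (Some y)| <= 1) ->
  exists c, tail_chain W x c.
Proof.
have [n] := ubnP (\max_(v : G) rk v - rk x); elim: n => // n IH in x *.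
rewrite ltnS => le xW x0 br.
have [c0 | [y yc]] := set_0Vmem (children W (Some x)).
  by exists [::]; rewrite /= xW x0 c0 eqxx.
have ec : children W (Some x) = [set y].
  by apply/eqP; rewrite eq_sym eqEcard sub1set yc cards1 br.
move: yc; rewrite inE => /and3P[yW y0 /eqP py].
have xy := parent_lt py.
have [||||c tc] := IH y => //.
- by have := leq_bigmax (F := rk) y; lia.
- by move=> z zW yz; apply: br => //; apply: leq_trans yz; apply: ltnW.
by exists (y :: c); rewrite /= xW x0 ec eqxx.
Qed.

Lemma tail_chain_cases W T : closed W ->
  [\/ exists x c, tail_chain W x c /\ size c = T,
      exists x c y d, [/\ tail_chain W x c, tail_chain W y d, parent x = parent y,
                          x != y & size c < T /\ size d < T]
    | #|W| <= k.+1 + T].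
Proof.
move=> clW.
have [/existsP[x0 br] | nbr] := boolP [exists y in W, 1 < #|children W (Some y)|].
  (* Descendants have larger rank, so nothing branches below the branching vertex [a] of largest
     rank. *)
  case: (@arg_maxnP _ x0 (fun y => (y \in W) && (1 < #|children W (Some y)|)) rk br).
  move=> a /andP[aW /card_gt1P[x [y [xc yc xy]]]] amax.
  move: xc yc; rewrite !inE => /and3P[xW x1 /eqP px] /and3P[yW y1 /eqP py].
  have ex z : z \in W -> 0 < rk z -> parent z = Some a -> exists c, tail_chain W z c.
    move=> zW z0 pz; apply: tail_chain_exists => // w wW zw.
    rewrite leqNgt; apply/negP => cw; have := amax w; rewrite wW cw => /(_ isT).
    by rewrite /geq /= leqNgt (leq_trans (parent_lt pz) zw).
  have [c tc] := ex x xW x1 px; have [d td] := ex y yW y1 py.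
  (* [size c] does not count [x], so a long chain is cut to its last [T + 1] vertices. *)
  have [lc | lc] := leqP T (size c).
    by constructor 1; apply: tail_chain_drop tc lc.
  have [ld | ld] := leqP T (size d).
    by constructor 1; apply: tail_chain_drop td ld.
  by constructor 2; exists x, c, y, d; rewrite px py.
have ex z : z \in W -> 0 < rk z -> exists c, tail_chain W z c.
  move=> zW z0; apply: tail_chain_exists => // w wW _.
  by rewrite leqNgt; apply: contra nbr => cw; apply/existsP; exists w; rewrite wW.
(* No vertex branches; only the root, which is not a vertex, still may. *)
have [/card_gt1P[x [y [xc yc xy]]] | ] := boolP (1 < #|children W None|).
  move: xc yc; rewrite !inE => /and3P[xW x1 /eqP px] /and3P[yW y1 /eqP py].
  have [c tc] := ex x xW x1; have [d td] := ex y yW y1.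
  have [lc | lc] := leqP T (size c).
    by constructor 1; apply: tail_chain_drop tc lc.
  have [ld | ld] := leqP T (size d).
    by constructor 1; apply: tail_chain_drop td ld.
  by constructor 2; exists x, c, y, d; rewrite px py.
rewrite -leqNgt => root1.
have [c0 | [x xc]] := set_0Vmem (children W None).
  constructor 3; suff -> : W = base by rewrite card_base leq_addr.
  apply/eqP; rewrite eqEsubset clW.1 andbT; apply/subsetP => v.
  have [n] := ubnP (rk v); elim: n => // n IH in v *; rewrite ltnS => vn vW.
  rewrite inE; apply: contraT; rewrite -lt0n => v0.
  case pv: (parent v) => [p|].
    have [pe p0] := parent_earlier pv.
    have := IH p (leq_trans (parent_lt pv) vn) (subsetP (clW.2 _ vW) _ pe).
    by rewrite inE eqn0Ngt p0.
  by have : v \in children W None; [rewrite inE vW v0 pv | rewrite c0 inE].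
have ec : children W None = [set x].
  by apply/eqP; rewrite eq_sym eqEcard sub1set xc cards1.
move: xc; rewrite inE => /and3P[xW x0 /eqP px].
have [c tc] := ex x xW x0.
have [lc | lc] := leqP T (size c).
  by constructor 1; apply: tail_chain_drop tc lc.
constructor 3; have [D0 cD] := tail_chain_child_closed tc.
(* Every vertex outside [base] descends from [x], the only child of the root. *)
suff sW : W \subset base :|: [set y in x :: c].
  apply: leq_trans (subset_leq_card sW) _; apply: leq_trans (leq_card_setU _ _).1 _.
  rewrite card_base leq_add2l; apply: leq_trans lc.
  by rewrite cardsE; apply: card_size.
apply/subsetP => v; have [n] := ubnP (rk v); elim: n => // n IH in v *.
rewrite ltnS => vn vW; rewrite in_setU !in_set.
have [// | v0] := posnP (rk v); rewrite orFb.
case pv: (parent v) => [p|].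
  have [pe p0] := parent_earlier pv.
  have := IH p (leq_trans (parent_lt pv) vn) (subsetP (clW.2 _ vW) _ pe).
  rewrite in_setU [p \in base]inE eqn0Ngt p0 /= => pD.
  by have := cD _ _ vW pv pD; rewrite in_set.
have : v \in children W None by rewrite inE vW v0 pv.
by rewrite ec !inE => ->.
Qed.

(** * How bags change along a chain *)

(** Apart from [x], the [k] vertices of [earlier y] all lie in [earlier x], which also has [k]. *)
Lemma card_earlierD x y : 0 < rk x -> parent y = Some x ->
  #|earlier x :\: earlier y| <= 1.
Proof.
move=> x0 py; have y0 := parent_gt0 py.
have sub : earlier y :\ x \subset earlier x :&: earlier y.
  apply/subsetP => u /setD1P[ux uy]; rewrite inE uy andbT.
  have := subsetP (earlier_sub_bag y0) u uy.
  by rewrite py /= in_setU1 (negbTE ux).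
have := subset_leq_card sub; have := cardsD1 x (earlier y).
by rewrite (cardsD (earlier x)) (card_earlier x0) (card_earlier y0); lia.
Qed.

Lemma card_bag x : 0 < rk x -> #|bag (parent x)| = k.+1.
Proof.
move=> x0; case px: (parent x) => [p|] //=.
have [_ p0] := parent_earlier px.
by rewrite cardsU1 (card_earlier p0) inE ltnn andbF.
Qed.

Lemma earlier_last_sub W x c (Q : {set G}) : tail_chain W x c -> earlier x \subset Q ->
  earlier (last x c) \subset Q :|: [set y in belast x c].
Proof.
elim: c x Q => [|y c IH] x Q tc sQ /=; first by rewrite subsetU ?sQ.
have py := tail_chain_parent tc.
have sy : earlier y \subset x |: Q.
  apply: subset_trans (earlier_sub_bag (parent_gt0 py)) _.
  by rewrite py /= setUS.
apply: subset_trans (IH _ _ (tail_chain_behead tc) sy) _.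
by apply/subsetP => u; rewrite !inE => /orP[/orP[]|] ->; rewrite ?orbT.
Qed.

(** Each step down the chain loses at most one old earlier neighbour. *)
Lemma card_bag_setD_last W x c (Q : {set G}) : tail_chain W x c ->
  #|Q :\: earlier (last x c)| <= #|Q :\: earlier x| + size c.
Proof.
elim: c x => [|y c IH] x tc /=; first by rewrite addn0.
have py := tail_chain_parent tc; have [_ x0] := parent_earlier py.
apply: leq_trans (IH _ (tail_chain_behead tc)) _.
rewrite addnS -addSn leq_add2r -addn1.
apply: leq_trans _ (leq_add (leqnn _) (card_earlierD x0 py)).
apply: leq_trans _ (leq_card_setU _ _).1; apply: subset_leq_card.
by apply/subsetP => u; rewrite in_setU !in_setD => /andP[-> ->]; case: (_ \in _).
Qed.

Lemma tail_chain_mem_parent W x c v : tail_chain W x c -> v \in c ->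
  exists2 p, p \in x :: c & parent v = Some p.
Proof.
elim: c x => // y c IH x tc; rewrite inE => /predU1P[-> | vc].
  by exists x; rewrite ?mem_head // (tail_chain_parent tc).
have [p pc pv] := IH _ (tail_chain_behead tc) vc.
by exists p => //; rewrite inE pc orbT.
Qed.

Lemma tail_chain_mem_sibling W x c y : tail_chain W x c -> parent x = parent y ->
  y \in x :: c -> x = y.
Proof.
move=> tc pxy; rewrite inE => /predU1P[-> // | yc].
have [p pc py] := tail_chain_mem_parent tc yc.
have [_ lt] := tail_chain_uniq tc; rewrite py in pxy.
have := parent_lt pxy; move: pc; rewrite inE => /predU1P[-> | /lt]; lia.
Qed.

(** Climbing both chains from a common leaf, one top is met on the other chain, which would then
    contain two distinct siblings. *)
Lemma tail_chain_last_neq W x c y d : tail_chain W x c -> tail_chain W y d ->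
  parent x = parent y -> x != y -> last x c != last y d.
Proof.
move=> tc td pxy xy; apply/negP => /eqP e.
suff [xd | yc] : x \in y :: d \/ y \in x :: c.
- by move/eqP: xy; apply; apply/esym/(tail_chain_mem_sibling td).
- by move/eqP: xy; apply; apply: tail_chain_mem_sibling tc pxy yc.
have : last x c \in y :: d by rewrite e mem_last.
elim: c x tc {pxy xy e} => [|x' c IH] x tc /=; first by left.
move=> /(IH _ (tail_chain_behead tc))[|yc]; last by right; rewrite inE yc orbT.
rewrite inE => /predU1P[-> | xd]; first by right; rewrite !inE eqxx orbT.
have [p pd] := tail_chain_mem_parent td xd.
by rewrite (tail_chain_parent tc) => -[->]; left.
Qed.

Lemma child_closed_last2 W x c y d : tail_chain W x c -> tail_chain W y d ->
  child_closed W [set last x c; last y d].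
Proof.
move=> /tail_chain_last/tail_chain_child_closed[h0 h].
move=> /tail_chain_last/tail_chain_child_closed[h0' h'].
split=> [v | v p vW pv].
  by case/set2P => ->; [apply: h0 | apply: h0']; rewrite in_set mem_head.
case/set2P => e; rewrite !inE.
  by have := h _ _ vW pv; rewrite e !inE eqxx => /(_ isT) ->.
by have := h' _ _ vW pv; rewrite e !inE eqxx => /(_ isT) ->; rewrite orbT.
Qed.

(** * Odd colours and the effect of one new vertex *)

Section Coloring.

Variable N : nat.
Implicit Types (W : {set G}) (phi : G -> 'I_N).

Definition odd_colors W phi v : {set 'I_N} :=
  [set i | odd #|[set u in W | adj v u & phi u == i]|].

Definition proper_on W phi : Prop :=
  {in W &, forall u v, adj u v -> phi u != phi v}.

(** Every vertex must have an odd colour, as no vertex of a closed set is isolated in it when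
    [k > 0]. *)
Definition odd_coloring_on W phi : Prop :=
  proper_on W phi /\ {in W, forall v, odd_colors W phi v != set0}.

Definition recolor phi x (i : 'I_N) u := if u == x then i else phi u.

(** Symmetric difference with [[set i]]: how the odd colours of a vertex change when it gains a
    neighbour coloured [i]. *)
Definition toggle (A : {set 'I_N}) i : {set 'I_N} := [set j | (j \in A) (+) (i == j)].

Lemma toggle_eq0 A i : toggle A i = set0 -> A = [set i].
Proof.
move/setP => e; apply/setP => j; have := e j; rewrite !inE (eq_sym j).
by case: (j \in A); case: eqP.
Qed.

Lemma toggleK A i : toggle (toggle A i) i = A.
Proof. by apply/setP => j; rewrite !inE -addbA addbb addbF. Qed.

Lemma odd_colors_recolor W phi x i v : x \notin W ->
  odd_colors (x |: W) (recolor phi x i) v =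
  if adj v x then toggle (odd_colors W phi v) i else odd_colors W phi v.
Proof.
move=> xW; apply/setP => j.
have eS : [set u in x |: W | adj v u & recolor phi x i u == j] =
          if adj v x && (i == j) then x |: [set u in W | adj v u & phi u == j]
          else [set u in W | adj v u & phi u == j].
  apply/setP => u; rewrite /recolor (fun_if (fun A : {set G} => u \in A)) !inE.
  have [-> | _] := eqVneq u x; last by case: (adj v x && _).
  by rewrite (negbTE xW) /=; case: (adj v x && _).
rewrite (fun_if (fun A : {set 'I_N} => j \in A)) !inE eS.
case: (adj v x) => //=; case: eqP => _; rewrite ?addbF ?addbT //.
by rewrite cardsU1 inE (negbTE xW).
Qed.

Lemma adj_earlier W x v : closed W -> x \notin W -> 0 < rk x -> v \in W ->
  adj v x = (v \in earlier x).
Proof.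
move=> clW xW x0 vW; apply/idP/idP; last by rewrite inE adj_sym => /andP[].
by rewrite adj_sym; apply: (neighbor_closed clW xW x0 vW).
Qed.

Lemma proper_earlier_inj W phi x : proper_on W phi -> 0 < rk x ->
  earlier x \subset W -> {in earlier x &, injective phi}.
Proof.
move=> pr x0 sW u v uK vK e; apply/eqP; apply: contraT => uv.
have := pr u v (subsetP sW _ uK) (subsetP sW _ vK) (earlier_clique x0 uK vK uv).
by rewrite e eqxx.
Qed.

(** The neighbours of [x] in [W] are its earlier ones, a clique, so each of their colours occurs
    exactly once. *)
Lemma odd_colors_new W phi x i : closed W -> x \notin W -> 0 < rk x ->
  earlier x \subset W -> proper_on W phi ->
  odd_colors (x |: W) (recolor phi x i) x = phi @: earlier x.
Proof.
move=> clW xW x0 sW pr; rewrite odd_colors_recolor // adj_irr.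
apply/setP => j; rewrite inE.
have [/imsetP[u uK ->] | nj] := boolP (j \in phi @: earlier x).
  rewrite (_ : [set _ in _ | _ & _] = [set u]) ?cards1 //.
  apply/setP => w; rewrite !inE; apply/and3P/eqP => [[wW aw /eqP e] | ->].
    apply: (proper_earlier_inj pr x0 sW) => //.
    by apply: neighbor_closed clW _ _ _ _.
  by rewrite (subsetP sW) //; move: uK; rewrite inE => /andP[].
rewrite (_ : [set _ in _ | _ & _] = set0) ?cards0 //.
apply/setP => w; rewrite !inE; apply: contraNF nj => /and3P[wW aw /eqP <-].
by apply: imset_f; apply: neighbor_closed clW _ _ _ _.
Qed.

Lemma proper_on_new W phi x i : closed W -> x \notin W -> 0 < rk x ->
  proper_on W phi -> i \notin phi @: earlier x ->
  proper_on (x |: W) (recolor phi x i).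
Proof.
move=> clW xW x0 pr ni.
have new v : v \in W -> adj v x -> phi v != i.
  move=> vW; rewrite (adj_earlier clW) // => vK.
  by apply: contraNneq ni => <-; apply: imset_f.
have ne u : u \in W -> (u == x) = false.
  by move=> uW; apply: contraNF xW => /eqP <-.
move=> u v /setU1P[-> | uW] /setU1P[-> | vW]; rewrite /recolor ?adj_irr ?eqxx ?ne //.
- by rewrite adj_sym eq_sym; apply: new.
- exact: new.
- exact: pr.
Qed.

Lemma card_imset_earlier W phi x : proper_on W phi -> 0 < rk x ->
  earlier x \subset W -> #|phi @: earlier x| = k.
Proof.
by move=> pr x0 sW; rewrite card_in_imset ?card_earlier //; apply: proper_earlier_inj sW.
Qed.

Lemma imset_earlier_neq0 phi x : 0 < rk x -> phi @: earlier x != set0.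
Proof. by move=> x0; rewrite imset_eq0 -card_gt0 card_earlier. Qed.

(** * Choosing colours for a long chain *)

(** A new neighbour coloured [i] empties [O v] only if [O v] is [[set i]], so each vertex forbids at
    most one colour. *)
Lemma card_singletons (T : finType) (S : {set T}) (O : T -> {set 'I_N}) :
  #|[set i | [exists v in S, O v == [set i]]]| <= #|[set v in S | #|O v| == 1]|.
Proof.
set S' := [set v in S | _].
apply: (@leq_trans #|\bigcup_(v in S') O v|).
  apply/subset_leq_card/subsetP => i; rewrite inE => /exists_inP[v vS /eqP e].
  by apply/bigcupP; exists v; rewrite ?e ?set11 // in_set vS e cards1.
apply: (@leq_trans (\sum_(v in S') #|O v|)).
  apply: (big_ind2 (fun (A : {set 'I_N}) n => #|A| <= n)) => //; first by rewrite cards0.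
  move=> A a B b Aa Bb; exact: leq_card_setU_trans.
by rewrite -sum1_card leq_sum // => v; rewrite inE => /andP[_ /eqP ->].
Qed.

(* Averaging over the colours outside [F]: each of the fewer than ['C(m, r)]
   sets [O v] contains at most [r] of them. *)
Lemma pick_color (A : {set G}) (O : G -> {set 'I_N}) (F : {set 'I_N}) m r :
  {in A, forall v, #|O v| <= r.+1} -> #|F| + m.+1 <= N -> #|A| < 'C(m.+1, r.+1) ->
  exists2 i, i \notin F & #|[set v in A | i \in O v]| < 'C(m, r).
Proof.
move=> hO hF hA.
have [/exists_inP[i iF hi] | no] :=
  boolP [exists i in ~: F, #|[set v in A | i \in O v]| < 'C(m, r)].
  by exists i => //; rewrite inE in iF.
(* If no colour works, count in two ways the pairs of a colour outside [F] and a vertex of [A] whose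
   set contains it. *)
have lo : #|~: F| * 'C(m, r) <= \sum_(i in ~: F) #|[set v in A | i \in O v]|.
  rewrite -sum_nat_const; apply: leq_sum => i iF; rewrite leqNgt.
  by apply: contra no => hi; apply/exists_inP; exists i.
have hi : \sum_(i in ~: F) #|[set v in A | i \in O v]| <= #|A| * r.+1.
  apply: (@leq_trans (\sum_i #|[set v in A | i \in O v]|)).
    by rewrite [X in _ <= X](bigID (mem (~: F))) leq_addr.
  under eq_bigr do rewrite -sum1dep_card big_mkcondr.
  rewrite exchange_big /= -sum_nat_const; apply: leq_sum => v vA.
  by rewrite -big_mkcond /= sum1_card hO.
have cF : m.+1 <= #|~: F| by have := cardsC F; rewrite card_ord; lia.
(* [m.+1 * 'C(m, r) = r.+1 * 'C(m.+1, r.+1)], so the two counts contradict the bound on [#|A|]. *)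
have := mul_bin_diag m.+1 r; rewrite /= => e.
have : m.+1 * 'C(m, r) <= #|A| * r.+1.
  by apply: leq_trans (leq_trans lo hi); rewrite leq_mul2r cF orbT.
rewrite e mulnC leq_mul2r /=; lia.
Qed.

Lemma odd_colors_old W phi x i v : closed W -> x \notin W -> 0 < rk x -> v \in W ->
  odd_colors (x |: W) (recolor phi x i) v =
  if v \in earlier x then toggle (odd_colors W phi v) i else odd_colors W phi v.
Proof. by move=> clW xW x0 vW; rewrite odd_colors_recolor // (adj_earlier clW). Qed.

(* [U] holds the colours already spent on the chain. A vertex of [earlier x] is
   counted if it could still end with no odd colour, that is, if its odd colours
   may be exactly the unused colours given to the rest of the chain. *)
Lemma chain_extend X L t c x (U : {set 'I_N}) phi :
  N = k + 2 * L + 1 -> t <= k -> t <= 2 * L ->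
  closed X -> tail_chain X x c ->
  let W := X :\: [set y in x :: c] in
  proper_on W phi ->
  {in W :\: earlier x, forall v, odd_colors W phi v != set0} ->
  #|U| + (size c).+1 = t ->
  #|[set v in earlier x | (#|odd_colors W phi v| == (size c).+1)
                          && [disjoint odd_colors W phi v & U]]|
    < 'C(2 * L - t + (size c).+1, (size c).+1) ->
  exists psi, odd_coloring_on X psi.
Proof.
move=> eN tk tL clX; elim: c x U phi => [|y c IH] x U phi tc W pr gd cU alive_lt.
all: have [xX x0] := tail_chain_mem tc (mem_head _ _).
all: have clW : closed W by apply: closed_setD clX (tail_chain_child_closed tc).
all: have xW : x \notin W by rewrite !inE eqxx.
all: have sW : earlier x \subset W
  by apply/subsetP => u uK; rewrite in_setD (subsetP (clX.2 _ xX)) // andbT in_set;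
     apply/negP => /predU1P[e|uc];
     [ by move: uK; rewrite e inE ltnn andbF
     | by have [_ /(_ _ uc)] := tail_chain_uniq tc;
          move: uK; rewrite inE => /andP[_]; lia ].
all: set A := [set v in earlier x | _] in alive_lt.
all: have cI := card_imset_earlier pr x0 sW.
(* Last vertex: since ['C(2 * L - t, 0) = 1], the chosen colour lies in the set of no counted
   vertex. *)
- have [|||i] := @pick_color A (odd_colors W phi) (phi @: earlier x :|: U) (2 * L - t) 0.
  + by move=> v; rewrite in_set => /and3P[_ /eqP -> _].
  + apply: (@leq_trans (k + (t - 1) + (2 * L - t).+1)); last by lia.
    by rewrite leq_add2r; apply: leq_card_setU_trans; rewrite ?cI // -cU addnK.
  + by move: alive_lt; rewrite /= addn1.
  rewrite inE negb_or => /andP[iI iU]; rewrite bin0 ltnS leqn0 cards_eq0 => /eqP A0.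
  exists (recolor phi x i).
  have -> : X = x |: W.
    apply/setP => u; rewrite in_setU1 in_setD in_set mem_seq1.
    by have [-> | _] := eqVneq u x.
  split; first exact: proper_on_new.
  move=> v /setU1P[-> | vW]; first by rewrite odd_colors_new // imset_earlier_neq0.
  rewrite odd_colors_old //; case: ifP => vK; last by apply: gd; rewrite in_setD vK.
  apply/eqP => /toggle_eq0 e; move/setP/(_ v): A0.
  by rewrite in_set in_set0 in_set vK e cards1 set11 disjoints1 iU.
(* A vertex of [earlier x] outside [earlier y] meets no further chain vertex and must be safe now.
   There is at most one, so [S] costs one colour. *)
- pose S := [set i | [exists v in earlier x :\: earlier y, odd_colors W phi v == [set i]]].
  have py := tail_chain_parent tc; have y0 := parent_gt0 py.
  have cS : #|S| <= 1.
    apply: leq_trans (card_singletons _ _) (leq_trans _ (card_earlierD x0 py)).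
    by apply/subset_leq_card/subsetP => v; rewrite inE => /andP[].
  have [|||i] := @pick_color A (odd_colors W phi) (phi @: earlier x :|: U :|: S)
                  (2 * L - t + (size c).+1) (size c).+1.
  + by move=> v; rewrite in_set => /and3P[_ /eqP -> _].
  (* The bound on forbidden colours and the [2 * L - t + size c + 2] colours required for averaging
     add up to exactly [N]. *)
  + apply: (@leq_trans (k + (t - (size c).+2) + 1 + (2 * L - t + (size c).+1).+1)).
      rewrite leq_add2r; apply: leq_card_setU_trans cS.
      by apply: leq_card_setU_trans; rewrite ?cI // -cU addnK.
    by rewrite /= in cU; lia.
  + by move: alive_lt; rewrite /= addnS.
  rewrite !in_setU !negb_or => /andP[/andP[iI iU] iS] A_lt.
  have eW : X :\: [set z in y :: c] = x |: W.
    have [] := tail_chain_uniq tc; rewrite cons_uniq => /andP[xc _] _.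
    apply/setP => u; rewrite !in_setU1 !in_setD !in_set (in_cons x).
    by have [-> | _] := eqVneq u x; rewrite ?xc ?xX.
  have tc' := tail_chain_behead tc.
  apply: (IH y (i |: U) (recolor phi x i)); rewrite // ?eW.
  + exact: proper_on_new.
  + move=> v /setDP[/setU1P[-> _ | vW vy]].
      by rewrite odd_colors_new // imset_earlier_neq0.
    rewrite odd_colors_old //; case: ifP => vK; last by apply: gd; rewrite in_setD vK.
    apply/eqP => /toggle_eq0 e; move: iS; rewrite inE => /exists_inP[].
    by exists v; rewrite ?e // in_setD vy.
  + by rewrite cardsU1 iU -cU add1n addSnnS.
  (* A vertex counted for [y] was counted for [x] with [i] among its odd colours, because its new
     set avoids [i]. *)
  apply: leq_ltn_trans A_lt; apply/subset_leq_card/subsetP => v.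
  rewrite in_set => /and3P[vy cv dis].
  (* The vertex [x] itself has [k >= t > size c + 1] odd colours, so it is not counted. *)
  have := subsetP (earlier_sub_bag y0) v vy; rewrite py => /setU1P[ev | vK].
    move: cv; rewrite ev odd_colors_new // cI => /eqP.
    by move: tk cU; rewrite /=; clear; lia.
  have vW := subsetP sW _ vK; move: cv dis; rewrite odd_colors_old // vK.
  set O := odd_colors W phi v => cv dis.
  have iO : i \in O.
    have := disjointFl dis (setU11 i U); rewrite inE eqxx addbT.
    by move/negbFE.
  have eO : O = i |: toggle O i.
    apply/setP => j; rewrite in_setU1 [j \in toggle _ _]in_set (eq_sym i).
    by case: eqP => [->|_]; rewrite ?iO ?addbF.
  have iT : i \notin toggle O i by rewrite in_set iO eqxx.
  rewrite in_set in_set vK iO andbT -/O {1}eO cardsU1 iT (eqP cv) add1n eqxx /=.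
  rewrite eO disjoints_subset subUset sub1set in_setC iU -disjoints_subset.
  by apply: disjointWr dis; apply: subsetUr.
Qed.

(* Each vertex of [D] spoils at most one of the colours of the rainbow set [C]. *)
Lemma odd_colors_rich W phi v (C D : {set G}) :
  C \subset W -> C \subset neighbors v -> {in C &, injective phi} ->
  {in W, forall u, adj v u -> u \in C :|: D} ->
  #|C| - #|D| <= #|odd_colors W phi v|.
Proof.
move=> CW Cv inj cover.
apply: (@leq_trans #|phi @: C :\: phi @: D|).
  rewrite leq_subLR; apply: leq_trans (leq_add (leq_imset_card phi (mem D)) (leqnn _)).
  rewrite -(card_in_imset inj); apply: leq_trans _ (leq_card_setU _ _).1.
  by apply/subset_leq_card/subsetP => i iC; rewrite in_setU in_setD iC andbT orbN.
apply/subset_leq_card/subsetP => _ /setDP[/imsetP[u uC ->] nD]; rewrite in_set.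
rewrite (_ : [set _ in _ | _ & _] = [set u]) ?cards1 //.
apply/setP => w; rewrite !inE; apply/and3P/eqP => [[wW aw /eqP e] | ->].
  have /setUP[wC | wD] := cover _ wW aw; first exact: inj.
  by rewrite -e imset_f in nD.
by rewrite (subsetP CW) //; have := subsetP Cv _ uC; rewrite inE.
Qed.

(** * Pruning two short sibling chains *)

(** The [k] earlier neighbours of [v] have distinct colours; its other neighbours in [R] are later,
    hence on the chain, and differ from [v] and from the removed leaf. *)
Lemma tail_chain_rich X (R : {set G}) phi x c v :
  closed X -> tail_chain X x c -> R \subset X -> closed R -> last x c \notin R ->
  proper_on R phi -> v \in R -> v \in x :: c ->
  k - (size c).-1 <= #|odd_colors R phi v|.
Proof.
move=> clX tc RX clR zR pr vR vc; have [_ v0] := tail_chain_mem tc vc.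
have sK := clR.2 _ vR.
pose D := [set u in x :: c] :\ v :\ last x c.
have cD : #|D| <= (size c).-1.
  have cxc : #|[set u in x :: c]| <= (size c).+1 by rewrite cardsE; apply: card_size.
  have := cardsD1 v [set u in x :: c]; rewrite in_set vc.
  have := cardsD1 (last x c) ([set u in x :: c] :\ v).
  rewrite in_setD1 in_set mem_last andbT.
  have -> : last x c != v by apply: contraNneq zR => ->.
  by rewrite -/D; lia.
apply: leq_trans (leq_sub2l _ cD) _; rewrite -(card_earlier v0).
apply: odd_colors_rich => //.
- by apply/subsetP => u; rewrite !inE => /andP[].
- exact: proper_earlier_inj pr v0 sK.
move=> u uR vu; rewrite in_setU.
have [uK | uK] := boolP (u \in earlier v); rewrite ?uK //=.
have uX := subsetP RX _ uR.
have vu' : v \in earlier u.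
  move: uK; rewrite !inE vu adj_sym vu /= -leqNgt leq_eqVlt.
  by case/predU1P => // e; rewrite -(rk_inj v0 e) adj_irr in vu.
have uc : u \in [set u in x :: c].
  by apply: (later_in_child_closed clX (tail_chain_child_closed tc) uX vu'); rewrite in_set.
rewrite !in_setD1 uc andbT; apply/andP; split.
  by apply: contraNneq zR => <-.
by apply: contraTneq vu => ->; rewrite adj_irr.
Qed.

Lemma two_leaves_extend X L x c y d phi :
  N = k + 2 * L + 1 -> L <= k -> (size c).+1 + (size d).+1 <= L ->
  closed X -> tail_chain X x c -> tail_chain X y d ->
  parent x = parent y -> x != y ->
  odd_coloring_on (X :\: [set last x c; last y d]) phi ->
  exists psi, odd_coloring_on X psi.
Proof.
move=> eN Lk sz clX tc td pxy xy.
have zz' := tail_chain_last_neq tc td pxy xy.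
have [xX x0] := tail_chain_mem tc (mem_head _ _).
have [yX y0] := tail_chain_mem td (mem_head _ _).
have [zX z0] := tail_chain_mem tc (mem_last _ _).
have [z'X z'0] := tail_chain_mem td (mem_last _ _).
have leafz := tail_chain_child_closed (tail_chain_last tc).
have leafz' := tail_chain_child_closed (tail_chain_last td).
have no_later w u : child_closed X [set v in [:: w]] -> u \in X -> u != w ->
    w \notin earlier u.
  move=> leaf uX; apply: contra => wu.
  have := later_in_child_closed clX leaf uX wu.
  by rewrite !in_set !mem_seq1 eqxx => /(_ isT).
set z := last x c in zz' zX z0 leafz *; set z' := last y d in zz' z'X z'0 leafz' *.
set R := X :\: [set z; z'] => -[pr gd].
have zz'K : z \notin earlier z' by apply: no_later; rewrite // eq_sym.
have z'zK : z' \notin earlier z by apply: no_later.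
have clR : closed R.
  exact: closed_setD (child_closed_last2 tc td).
have subR w : w \in X -> z \notin earlier w -> z' \notin earlier w ->
    earlier w \subset R.
  move=> wX nz nz'; apply/subsetP => u uK; rewrite !in_setD (subsetP (clX.2 _ wX)) //.
  rewrite andbT !inE negb_or; apply/andP.
  by split; [apply: contraNneq nz | apply: contraNneq nz'] => <-.
have irr w : w \notin earlier w by rewrite inE ltnn andbF.
have sz1 : earlier z \subset R by apply: subR.
have sz2 : earlier z' \subset R by apply: subR.
have zR : z \notin R by rewrite !inE eqxx.
have z'R : z' \notin R by rewrite !inE eqxx orbT.
(* Only vertices of [S] see exactly one new leaf; those seeing both are toggled twice by the same
   colour. *)
pose S := [set v | (v \in earlier z) (+) (v \in earlier z')].
pose B := [set i | [exists v in S, odd_colors R phi v == [set i]]].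
pose Q := bag (parent x).
have sQ1 : earlier z \subset Q :|: [set u in belast x c].
  by apply: earlier_last_sub tc _; apply: earlier_sub_bag.
have sQ2 : earlier z' \subset Q :|: [set u in belast y d].
  by apply: earlier_last_sub td _; rewrite /Q pxy; apply: earlier_sub_bag.
have cQ : #|Q| = k.+1 by apply: card_bag.
have cQD w e : tail_chain X w e -> 0 < rk w -> parent w = parent x ->
    #|Q :\: earlier (last w e)| <= (size e).+1.
  move=> te w0 pw; apply: leq_trans (card_bag_setD_last Q te) _.
  have sw : earlier w \subset Q by rewrite /Q -pw; apply: earlier_sub_bag.
  by rewrite cardsD (setIidPr sw) cQ (card_earlier w0) subSnn.
have cB : #|B| <= (size c).+1 + (size d).+1.
  apply: leq_trans (card_singletons _ _) _.
  apply: leq_trans (leq_card_setU_trans (cQD _ _ tc x0 erefl) (cQD _ _ td y0 (esym pxy))).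
  apply/subset_leq_card/subsetP => v; rewrite in_set => /andP[vS /eqP c1].
  (* Chain vertices left in [R] have more than one odd colour, so a vertex of [S] with a single one
     lies in the bag [Q]. *)
  have rich w e : tail_chain X w e -> last w e \notin R -> (size e).+1 <= L ->
      v \in R -> v \in w :: e -> False.
    move=> te lR le vR ve.
    have RX : R \subset X by apply: subsetDl.
    have := tail_chain_rich clX te RX clR lR pr vR ve.
    by rewrite c1; move: le Lk sz; clear; lia.
  have vQ : v \in Q.
    move: vS; rewrite in_set.
    have [v1 _ | _ /= v2] := boolP (v \in earlier z).
      have /setUP[// | ] := subsetP sQ1 _ v1; rewrite in_set => /mem_belast vb.
      by case: (rich x c) => //; [by move: sz; clear; lia | apply: (subsetP sz1)].
    have /setUP[// | ] := subsetP sQ2 _ v2; rewrite in_set => /mem_belast vb.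
    by case: (rich y d) => //; [by move: sz; clear; lia | apply: (subsetP sz2)].
  move: vS; rewrite in_set in_setU !in_setD vQ !andbT.
  by case: (v \in earlier z); case: (v \in earlier z').
have cF : #|phi @: (earlier z :|: earlier z') :|: B| < N.
  (* The bound is [k + 3 + 2 * (size c + size d)], and [size c + size d + 2 <= L]. *)
  apply: (@leq_ltn_trans (k.+1 + (size c + size d) + ((size c).+1 + (size d).+1))).
    apply: leq_card_setU_trans cB; apply: leq_trans (leq_imset_card _ _) _.
    apply: (@leq_trans #|Q :|: ([set u in belast x c] :|: [set u in belast y d])|).
      apply: subset_leq_card; rewrite subUset; apply/andP; split.
        by apply: subset_trans sQ1 _; rewrite setUA subsetUl.
      by apply: subset_trans sQ2 _; rewrite setUS // subsetUr.
    apply: leq_card_setU_trans; first by rewrite cQ.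
    apply: leq_card_setU_trans; rewrite cardsE;
    by apply: leq_trans (card_size _) _; rewrite size_belast.
  by move: eN sz; clear; lia.
have [i] : exists i, i \notin phi @: (earlier z :|: earlier z') :|: B.
  apply/existsP; rewrite -negb_forall; apply/negP => /forallP all.
  have : [set: 'I_N] \subset phi @: (earlier z :|: earlier z') :|: B by apply/subsetP.
  by move/subset_leq_card; rewrite cardsT card_ord leqNgt cF.
rewrite in_setU negb_or imsetU in_setU negb_or => /andP[/andP[i1 i2] iB].
pose phi1 := recolor phi z i; pose R1 := z |: R.
have eX : X = z' |: R1.
  apply/setP => u; rewrite !inE; have [->//|_] := eqVneq u z'.
  by have [->|_] := eqVneq u z; rewrite ?orbF.
have eR1 : R1 = X :\: [set v in [:: z']].
  apply/setP => u; rewrite !inE; have [->|_] := eqVneq u z.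
    by rewrite zz' zX.
  by [].
have clR1 : closed R1 by rewrite eR1; apply: closed_setD.
have z'R1 : z' \notin R1 by rewrite eR1 !inE eqxx.
have pr1 : proper_on R1 phi1 by apply: proper_on_new.
have sz21 : earlier z' \subset R1 by apply: subset_trans sz2 (subsetUr _ _).
(* The two leaves are not adjacent, so colouring [z] does not change the colours seen by [z']. *)
have e1 : phi1 @: earlier z' = phi @: earlier z'.
  apply: eq_in_imset => u uK; rewrite /phi1 /recolor; case: eqP => // e.
  by rewrite e (negbTE zz'K) in uK.
exists (recolor phi1 z' i); rewrite eX; split.
  by apply: proper_on_new; rewrite ?e1.
move=> v /setU1P[-> | ]; first by rewrite odd_colors_new // imset_earlier_neq0.
move=> vR1; rewrite odd_colors_old //; move: vR1 => /setU1P[-> | vR].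
  by rewrite (negbTE zz'K) odd_colors_new // imset_earlier_neq0.
rewrite odd_colors_old //.
have [v1|v1] := boolP (v \in earlier z); have [v2|v2] := boolP (v \in earlier z').
- by rewrite toggleK gd.
- apply/eqP => /toggle_eq0 e; move: iB; rewrite in_set => /exists_inP[].
  by exists v; rewrite ?e // in_set v1 (negbTE v2).
- apply/eqP => /toggle_eq0 e; move: iB; rewrite in_set => /exists_inP[].
  by exists v; rewrite ?e // in_set v2 (negbTE v1).
- exact: gd.
Qed.

(** * Small sets and the induction *)

(** With pairwise distinct colours, any single neighbour supplies an odd colour. *)
Lemma rainbow W : closed W -> #|W| <= N -> exists phi, odd_coloring_on W phi.
Proof.
move=> clW cW.
have N0 : 0 < N.
  by apply: leq_trans cW; apply: leq_trans (subset_leq_card clW.1); rewrite card_base.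
(* The default of [insubd] is never reached on [W]. *)
pose phi v : 'I_N := insubd (Ordinal N0) (index v (enum W)).
have inj : {in W &, injective phi}.
  move=> u v uW vW /(congr1 val); rewrite !val_insubd.
  have lt w : w \in W -> index w (enum W) < N.
    by move=> wW; apply: leq_trans cW; rewrite cardE index_mem mem_enum.
  rewrite !lt // => e; rewrite -(nth_index u (s := enum W) (x := u)) ?mem_enum //.
  by rewrite e nth_index ?mem_enum.
exists phi; split=> [u v uW vW uv | v vW].
  by apply: contraTneq uv => /inj -> //; rewrite adj_irr.
have [u uW vu] : exists2 u, u \in W & adj v u.
  have [v0 | v0] := posnP (rk v).
    have vb : v \in base by rewrite inE v0.
    have : 0 < #|base :\ v| by have := cardsD1 v base; rewrite vb card_base; lia.
    move/card_gt0P => [u /setD1P[uv ub]]; exists u; first exact: (subsetP clW.1).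
    by apply: base_clique; rewrite // eq_sym.
  have : 0 < #|earlier v| by rewrite card_earlier.
  move/card_gt0P => [u uK]; exists u; first exact: (subsetP (clW.2 _ vW)).
  by move: uK; rewrite inE => /andP[].
apply/set0Pn; exists (phi u); rewrite in_set.
rewrite (_ : [set _ in _ | _ & _] = [set u]) ?cards1 //.
apply/setP => w; rewrite !inE; apply/and3P/eqP => [[wW _ /eqP] | -> //].
by move/inj; apply.
Qed.

Lemma closed_odd_colorable L W : 0 < L -> N = k + 2 * L + 1 -> k < 2 ^ L -> L <= k ->
  closed W -> exists phi, odd_coloring_on W phi.
Proof.
move=> L0 eN kL Lk; have [n] := ubnP #|W|; elim: n => // n IH in W *.
rewrite ltnS => Wn clW.
(* With [T = L./2], a long chain has [t = L./2 + 1] vertices and two short ones have at most [L]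
   together. *)
case: (tail_chain_cases L./2 clW) =>
  [[x [c [tc sc]]] | [x [c [y [d [tc td pxy xy [sc sd]]]]]] | cW].
- have [xW x0] := tail_chain_mem tc (mem_head _ _).
  have [||phi [pr gd]] := IH (W :\: [set u in x :: c]).
  + apply: leq_trans _ Wn; rewrite (cardsD1 x W) xW ltnS subset_leq_card // setDS //.
    by rewrite sub1set in_set mem_head.
  + exact: closed_setD (tail_chain_child_closed tc).
  apply: (@chain_extend W L L./2.+1 c x set0 phi) => //; try lia.
  + by move=> v /setDP[vW _]; apply: gd.
  + by rewrite cards0 sc.
  (* Before any choice, all [k] earlier neighbours of [x] may be at risk, and [k < 2 ^ L]. *)
  rewrite sc subnK; last by lia.
  apply: leq_ltn_trans (leq_trans kL (expn2_le_bin_half L0)).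
  rewrite -(card_earlier x0); apply/subset_leq_card/subsetP => v.
  by rewrite in_set => /andP[].
- have [||phi od] := IH (W :\: [set last x c; last y d]).
  + have [lW _] := tail_chain_mem tc (mem_last _ _).
    apply: leq_trans _ Wn; rewrite (cardsD1 (last x c) W) lW ltnS.
    by rewrite subset_leq_card // setDS // sub1set set21.
  + exact: closed_setD (child_closed_last2 tc td).
  by apply: (@two_leaves_extend W L x c y d phi) => //; lia.
- by apply: rainbow => //; lia.
Qed.

End Coloring.

End Elimination.

(** * Ranks from the construction sequence *)

Theorem theorem1p3 (k : nat) (G : sgraph) :
  0 < k -> ktree k G -> odd_colorable (k + 2 * trunc_log 2 k + 3) G.
Proof.
move=> k0 [s [V [[V0 cV0] Vs step]]].
have exV v : exists i, v \in V i by exists s; rewrite Vs in_setT.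
(* The rank is the first stage containing the vertex, so the starting clique gets rank 0. *)
pose rk v := ex_minn (exV v).
have V_rk v : v \in V (rk v) by rewrite /rk; case: ex_minnP.
have rk_min v i : v \in V i -> rk v <= i by rewrite /rk; case: ex_minnP => m _; apply.
(* Stages after [s] are arbitrary, hence the bound [j <= s]. *)
have mono j : j <= s -> forall i, i <= j -> V i \subset V j.
  elim: j => [|j IH] js i; first by rewrite leqn0 => /eqP ->.
  rewrite leq_eqVlt => /predU1P[-> // | ij].
  apply: subset_trans (IH (ltnW js) _ ij) _.
  by have [x [_ -> _ _]] := step _ js; apply: subsetUr.
have mem_V v i : i <= s -> (v \in V i) = (rk v <= i).
  move=> le; apply/idP/idP => [|rv]; first exact: rk_min.
  exact: (subsetP (mono _ le _ rv)).
have new v i : rk v = i.+1 -> [/\ i < s, V i.+1 = v |: V i,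
    is_clique (earlier rk v) & #|earlier rk v| = k].
  move=> rv; have is_ : i < s by rewrite -rv; apply: rk_min; rewrite Vs in_setT.
  have [x [xV eV cl cK]] := step _ is_.
  have vx : v = x.
    have := V_rk v; rewrite rv eV => /setU1P[// | ].
    by rewrite (mem_V _ _ (ltnW is_)) rv ltnn.
  have eK : earlier rk v = neighbors x :&: V i.
    by apply/setP => u; rewrite !inE (mem_V _ _ (ltnW is_)) rv -vx.
  by rewrite eK vx.
have eb : base rk = V 0 by apply/setP => v; rewrite inE mem_V // leqn0.
have [||||||||||phi [pr od]] := @closed_odd_colorable G k rk k0 _ _ _ _ _
  (k + 2 * trunc_log 2 k + 3) (trunc_log 2 k).+1 setT.
- by rewrite eb.
- by rewrite eb.
- move=> u v; case ru: (rk u) => [//|i] _ /esym rv.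
  have [is_ eU _ _] := new _ _ ru; have := V_rk v; rewrite rv eU => /setU1P[// | ].
  by rewrite (mem_V _ _ (ltnW is_)) rv ltnn.
- by move=> v; case rv: (rk v) => [//|i] _; have [] := new _ _ rv.
- by move=> v; case rv: (rk v) => [//|i] _; have [] := new _ _ rv.
- by [].
- lia.
- exact: trunc_log_ltn.
(* [trunc_log 2 k < 2 ^ trunc_log 2 k <= k] gives [L <= k]. *)
- by apply: leq_trans (ltn_expl _ _) (trunc_logP _ k0).
- by split=> [|v _]; apply: subsetT.
exists phi; split=> [u v | v _]; first by apply: pr; rewrite in_setT.
have /set0Pn[i] := od v (in_setT v); rewrite in_set => oi; exists i.
rewrite (_ : _ :&: _ = [set u in [set: G] | adj v u & phi u == i]) //.
by apply/setP => u; rewrite !inE andbC.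
Qed.
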